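(* Let $N=2^e\cdot t+1>5$, where $t$ is odd and $2^e>t>0$, and suppose that $5\nmid t$. Then $N$ is prime if and only if $$a^{(N-1)/2}\equiv -1\pmod{N},$$ where $$a=\begin{cases}5, & \text{if } N\equiv 0,2,3\pmod 5;\\[2pt] \dfrac{-5\pm\sqrt5}{2} \pmod N, & \text{if } N\equiv 4\pmod 5.\end{cases}$$
   Context: Here $e$ and $t$ are integers; numbers $N=2^e\cdot t+1$ with $t$ odd and $2^e>t>0$ are called Proth numbers. Since $5\nmid t$, the case $N\equiv1\pmod 5$ does not occur. $\sqrt{x}\pmod N$ denotes a fixed square root of $x$ modulo $N$, so in the case $N\equiv4\pmod 5$ the symbol $\sqrt5$ denotes a square root of $5$ modulo $N$, and either choice of sign may be used. Division by $2$ is modulo the odd number $N$. *)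

(* Defs.v *)
From HB Require Import structures.
From mathcomp Require Import all_boot all_order all_algebra.
Set Implicit Arguments.
Unset Strict Implicit.
Unset Printing Implicit Defensive.
Import GRing.Theory.
Local Open Scope ring_scope.

(* [proth_base N a]: the residue [a] is an admissible base for the primality
   test of [N].  When N = 4 mod 5 the base depends on the choice of a square
   root [s] of 5 modulo [N]; if [N] is composite there may be none, and then
   no residue is a base.  Division by 2 is division in the ring 'Z_N, which is
   meaningful because it is only used for odd N > 5 (so that 2 is a unit and
   'Z_N is the ring of integers modulo N). *)
Definition proth_base (N : nat) (a : 'Z_N) : Prop :=
  (N %% 5 \in [:: 0; 2; 3])%N /\ a = 5%:R
  \/ (N %% 5 = 4)%N /\
     exists s : 'Z_N, s ^+ 2 = 5%:R /\
       (a = (- 5%:R + s) / 2%:R \/ a = (- 5%:R - s) / 2%:R).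

Arguments proth_base : clear implicits.

(* Main.v *)
(* Sufficiency: if p is the least prime factor of N, then b = a^t satisfies
   b^(2^(e-1)) = -1 in F_p, which forces 2^e to divide p - 1; hence
   p^2 >= (2^e + 1)^2 > N and N = p is prime.
   Necessity: let N be prime and let z be a primitive fifth root of unity in an
   extension of F_N, so that Frobenius maps z to z^N. The Gauss sum
   g = z - z^2 - z^3 + z^4 has g^2 = 5 and g^N = -g when N = 2, 3 mod 5, while
   g^N = g (so g lies in F_N) when N = 4 mod 5. In the latter case the two
   values of (-5 +- sqrt 5)/2 are (z - z^4)^2 and (z^2 - z^3)^2, and Frobenius
   negates both z - z^4 and z^2 - z^3. *)
Require Import Defs.
From mathcomp Require Import all_boot all_order all_algebra.
From mathcomp Require Import finfield closed_field ring zify.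
Import GRing.Theory.
Local Open Scope ring_scope.

Lemma natr_Zp_eq0 (N n : nat) : (1 < N)%N ->
  ((n%:R : 'Z_N) == 0) = (N %| n)%N.
Proof. by move=> N1; rewrite -val_eqE /= val_Zp_nat. Qed.

(** Such a [y] has multiplicative order exactly 2^e, which divides the order of the unit group. *)
Lemma dvdn_pred_of_root_neg1 (F : finFieldType) (e : nat) (y : F) :
  (0 < e)%N -> (-1 : F) != 1 -> y ^+ (2 ^ e.-1) = -1 -> (2 ^ e %| #|F|.-1)%N.
Proof.
move=> e0 neg1 hy.
have F1 : (1 < #|F|)%N by apply: finNzRing_gt1.
have q0 : (0 < #|F|.-1)%N by lia.
have y0 : y != 0.
  apply: contra_eq_neq hy => ->; rewrite expr0n expn_eq0 /=.
  by rewrite eq_sym oppr_eq0 oner_eq0.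
have yq : y ^+ #|F|.-1 = 1.
  by apply: (mulfI y0); rewrite -exprS prednK ?expf_card ?mulr1 // ltnW.
rewrite pfactor_dvdn //; case: leqP => // hlt.
have [u u_odd hq] := pfactor_coprime (isT : prime 2) q0.
set k := logn 2 _ in hlt hq.
(* If the 2-adic valuation [k] of #|F| - 1 is below [e], then 2^(e-1) u is a multiple of #|F| - 1 =
   2^k u. This yields (-1)^u = 1, absurd for odd [u]. *)
have : (y ^+ (2 ^ e.-1)) ^+ u = 1.
  rewrite -exprM (_ : 2 ^ e.-1 * u = #|F|.-1 * 2 ^ (e.-1 - k))%N.
    by rewrite exprM yq expr1n.
  by rewrite hq -mulnA -expnD subnKC 1?mulnC //; lia.
rewrite hy -signr_odd -coprime2n u_odd expr1 => /eqP.
by rewrite (negbTE neg1).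
Qed.

Lemma proth_sufficient (e t : nat) (a : 'Z_(2 ^ e * t + 1)) :
  (1 < e)%N -> (0 < t < 2 ^ e)%N ->
  a ^+ ((2 ^ e * t + 1 - 1) %/ 2) = -1 -> prime (2 ^ e * t + 1).
Proof.
move=> e1 /andP[t0 te].
set N := (2 ^ e * t + 1)%N in a * => ha.
have E2 : (2 ^ e = 2 * 2 ^ e.-1)%N by rewrite -expnS prednK // ltnW.
have N1 : (1 < N)%N by rewrite /N; nia.
have hexp : ((N - 1) %/ 2 = t * 2 ^ e.-1)%N.
  by rewrite /N addnK E2 -mulnA mulKn // mulnC.
have p_pr : prime (pdiv N) by apply: pdiv_prime.
set p := pdiv N in p_pr *.
have Np : (p %| N)%N by apply: pdiv_dvd.
have p2 : (2 < p)%N.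
  rewrite ltn_neqAle prime_gt1 // andbT; apply/eqP=> p2.
  by move: Np; rewrite -p2 /N E2 -mulnA dvdn_addr // dvdn_mulr.
(* Lifting [a] to a natural number turns the congruence into a divisibility by [N], which passes to
   the factor [p] and then to an equation in F_p. *)
have hx : (p %| (a : nat) ^ ((N - 1) %/ 2) + 1)%N.
  apply: dvdn_trans Np _; rewrite -natr_Zp_eq0 // natrD natrX natr_Zp ha.
  by rewrite addNr.
have neg1 : (-1 : 'F_p) != 1.
  rewrite eq_sym -subr_eq0 opprK -[1 + 1]/(2%:R).
  by rewrite -(dvdn_pcharf (pchar_Fp p_pr)) gtnNdvd.
have hy : (((a : nat)%:R : 'F_p) ^+ t) ^+ (2 ^ e.-1) = -1.
  apply/eqP; rewrite -exprM -hexp -subr_eq0 opprK -natrX natr1 -addn1.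
  by rewrite -(dvdn_pcharf (pchar_Fp p_pr)).
have := dvdn_pred_of_root_neg1 'F_p e _ (ltnW e1) neg1 hy.
rewrite card_Fp // => /dvdn_leq lep.
apply: ltn_pdiv2_prime; rewrite -/p; first by lia.
by have := lep ltac:(lia); rewrite /N; nia.
Qed.

(** Vanishing of the fifth cyclotomic polynomial encodes primitivity of [z] (in characteristic other
    than 5) in a form directly usable in ring identities. *)
Lemma exists_fifth_root (F : countFieldType) :
  exists (K : fieldType) (f : {rmorphism F -> K}) (z : K),
    1 + z + z ^+ 2 + z ^+ 3 + z ^+ 4 = 0.
Proof.
have [K [f _]] := countable_algebraic_closure F.
pose P : {poly K} := \poly_(i < 5) 1.
have : size P != 1 by rewrite size_poly_eq ?oner_eq0.
case/closed_rootP=> z /rootP; rewrite horner_poly !big_ord_recr big_ord0 /=.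
rewrite !mul1r add0r expr0 expr1 => hz.
by exists K, f, z.
Qed.

Section FifthRoot.

Variables (K : fieldType) (p : nat) (z : K).
Hypotheses (charK : p \in [pchar K])
  (hz : 1 + z + z ^+ 2 + z ^+ 3 + z ^+ 4 = 0).

Definition gauss5 := z - z ^+ 2 - z ^+ 3 + z ^+ 4.

Lemma fifth_root_expr5 : z ^+ 5 = 1.
Proof.
apply/eqP; rewrite -subr_eq0.
have -> : z ^+ 5 - 1 = (z - 1) * (1 + z + z ^+ 2 + z ^+ 3 + z ^+ 4) by ring.
by rewrite hz mulr0.
Qed.

Lemma gauss5_sqr : gauss5 ^+ 2 = 5%:R.
Proof.
apply/eqP; rewrite -subr_eq0 /gauss5.
(* The first factor is the quotient by the fifth cyclotomic polynomial. *)
have -> : (z - z ^+ 2 - z ^+ 3 + z ^+ 4) ^+ 2 - 5%:R =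
  (z ^+ 4 - 3%:R * z ^+ 3 + z ^+ 2 + 5%:R * z - 5%:R) *
    (1 + z + z ^+ 2 + z ^+ 3 + z ^+ 4) by ring.
by rewrite hz mulr0.
Qed.

Lemma two_sqr_z14 : 2%:R * (z - z ^+ 4) ^+ 2 = - 5%:R - gauss5.
Proof.
(* Powers are split to expose z^5; once it is replaced by 1, the two sides differ exactly by the
   cyclotomic polynomial. *)
have -> : 2%:R * (z - z ^+ 4) ^+ 2 =
   2%:R * (z ^+ 2 - 2%:R * z ^+ 5 + z ^+ 5 * z ^+ 3) by ring.
rewrite fifth_root_expr5 /gauss5; apply/eqP; rewrite -subr_eq0.
set d := (X in X == 0).
have -> : d = 1 + z + z ^+ 2 + z ^+ 3 + z ^+ 4 by rewrite /d; ring.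
by rewrite hz.
Qed.

Lemma two_sqr_z23 : 2%:R * (z ^+ 2 - z ^+ 3) ^+ 2 = - 5%:R + gauss5.
Proof.
have -> : 2%:R * (z ^+ 2 - z ^+ 3) ^+ 2 =
   2%:R * (z ^+ 4 - 2%:R * z ^+ 5 + z ^+ 5 * z) by ring.
rewrite fifth_root_expr5 /gauss5; apply/eqP; rewrite -subr_eq0.
set d := (X in X == 0).
have -> : d = 1 + z + z ^+ 2 + z ^+ 3 + z ^+ 4 by rewrite /d; ring.
by rewrite hz.
Qed.

Lemma exprB_pchar (x y : K) : (x - y) ^+ p = x ^+ p - y ^+ p.
Proof. by rewrite -!(pFrobenius_autE charK) rmorphB. Qed.

Lemma exprD_pchar (x y : K) : (x + y) ^+ p = x ^+ p + y ^+ p.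
Proof. by rewrite -!(pFrobenius_autE charK) rmorphD. Qed.

Lemma fifth_root_exprX (i : nat) : (z ^+ i) ^+ p = z ^+ ((i * (p %% 5)) %% 5).
Proof. by rewrite modnMmr (expr_mod _ fifth_root_expr5) exprM. Qed.

Lemma fifth_root_frob : z ^+ p = z ^+ (p %% 5).
Proof. by rewrite (expr_mod _ fifth_root_expr5). Qed.

(** Frobenius multiplies exponents by p mod 5. The nonresidues 2 and 3 exchange {1, 4} with {2, 3},
    whose terms carry opposite signs. *)
Lemma gauss5_frobN : (p %% 5 = 2 \/ p %% 5 = 3)%N -> gauss5 ^+ p = - gauss5.
Proof.
rewrite /gauss5 exprD_pchar !exprB_pchar !fifth_root_exprX fifth_root_frob.
by case=> -> /=; rewrite ?expr1; ring.
Qed.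

Lemma gauss5_frob : (p %% 5 = 4)%N -> gauss5 ^+ p = gauss5.
Proof.
rewrite /gauss5 exprD_pchar !exprB_pchar !fifth_root_exprX fifth_root_frob.
by move=> -> /=; rewrite ?expr1; ring.
Qed.

Lemma z14_frob : (p %% 5 = 4)%N -> (z - z ^+ 4) ^+ p = - (z - z ^+ 4).
Proof.
rewrite exprB_pchar fifth_root_exprX fifth_root_frob => -> /=.
by rewrite expr1; ring.
Qed.

Lemma z23_frob : (p %% 5 = 4)%N ->
  (z ^+ 2 - z ^+ 3) ^+ p = - (z ^+ 2 - z ^+ 3).
Proof. by rewrite exprB_pchar !fifth_root_exprX => -> /=; ring. Qed.

End FifthRoot.

(** Cancelling [x] leaves x^(p-1) = -1. In the applications [x] is a square root of the base, so
    this does the work of Euler's criterion. *)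
Lemma half_power_of_frobN (K : fieldType) (p : nat) (x : K) :
  odd p -> x != 0 -> x ^+ p = - x -> (x ^+ 2) ^+ ((p - 1) %/ 2) = -1.
Proof.
move=> p_odd x0 hx; apply: (mulfI x0).
rewrite -exprM -exprS mulrN1 (_ : (2 * _).+1 = p) //; lia.
Qed.

(** X^q - X is the product of all X - y with y in [F]; after mapping to [K], one factor must vanish
    at [x]. *)
Lemma fixed_Frobenius_preimage (F : finFieldType) (K : fieldType)
    (f : {rmorphism F -> K}) (x : K) : x ^+ #|F| = x -> exists y, f y = x.
Proof.
move=> hx.
have /(congr1 (fun P => (map_poly f P).[x])) := finField_genPoly F.
rewrite rmorphB rmorphXn /= map_polyX !hornerE hx subrr.
rewrite rmorph_prod horner_prod => /esym/eqP/prodf_eq0[y _].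
rewrite /= rmorphB /= map_polyX map_polyC !hornerE subr_eq0 => /eqP ->.
by exists y.
Qed.

Section PrimeField.

Variables (p : nat).
Hypotheses (p_pr : prime p) (p5 : (5 < p)%N).

Let p_odd : odd p.
Proof. by case: (even_prime p_pr) => // p2; move: p5; rewrite p2. Qed.

Let neq0_5 (K : fieldType) : p \in [pchar K] -> (5%:R : K) != 0.
Proof.
by move=> charK; rewrite -(dvdn_pcharf charK) gtnNdvd.
Qed.

Let neq0_2 (K : fieldType) : p \in [pchar K] -> (2%:R : K) != 0.
Proof.
by move=> charK; rewrite -(dvdn_pcharf charK) gtnNdvd // (leq_trans _ p5).
Qed.

Lemma five_half_power : (p %% 5 = 2 \/ p %% 5 = 3)%N ->
  (5%:R : 'F_p) ^+ ((p - 1) %/ 2) = -1.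
Proof.
move=> hp; have [K [f [z hz]]] := exists_fifth_root 'F_p.
have charK : p \in [pchar K] by rewrite (fmorph_pchar f) pchar_Fp.
apply: (fmorph_inj f); rewrite rmorphXn rmorphN1 /= rmorph_nat.
rewrite -(gauss5_sqr _ z hz); apply: half_power_of_frobN => //.
  by rewrite -sqrf_eq0 gauss5_sqr // neq0_5.
exact: gauss5_frobN.
Qed.

Lemma exists_sqrt5 : (p %% 5 = 4)%N -> exists s : 'F_p, s ^+ 2 = 5%:R.
Proof.
move=> hp; have [K [f [z hz]]] := exists_fifth_root 'F_p.
have charK : p \in [pchar K] by rewrite (fmorph_pchar f) pchar_Fp.
have [|s hs] := fixed_Frobenius_preimage 'F_p K f (gauss5 K z).
  by rewrite card_Fp // (gauss5_frob _ _ _ charK).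
by exists s; apply: (fmorph_inj f); rewrite rmorphXn /= rmorph_nat hs gauss5_sqr.
Qed.

Lemma base4_half_power (s : 'F_p) : (p %% 5 = 4)%N -> s ^+ 2 = 5%:R ->
  ((- 5%:R + s) / 2%:R) ^+ ((p - 1) %/ 2) = -1.
Proof.
move=> hp hs; have [K [f [z hz]]] := exists_fifth_root 'F_p.
have charK : p \in [pchar K] by rewrite (fmorph_pchar f) pchar_Fp.
have K2 := neq0_2 _ charK; have K5 := neq0_5 _ charK.
have a0 : - 5%:R + f s != 0.
  (* Otherwise s = 5 in [K], so 25 = 5 and 20 = 0, impossible for p > 5. *)
  apply/eqP=> h; have fs : f s = 5%:R by rewrite -[RHS]addr0 -h addrA subrr add0r.
  have : (5%:R : K) ^+ 2 = 5%:R by rewrite -fs -rmorphXn hs rmorph_nat.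
  move/eqP; rewrite -subr_eq0.
  have -> : (5%:R : K) ^+ 2 - 5%:R = 5%:R * 2%:R * 2%:R by ring.
  by rewrite !mulf_eq0 (negbTE K2) (negbTE K5).
apply: (fmorph_inj f); rewrite rmorphXn rmorphN1 fmorph_div rmorphD rmorphN /=.
rewrite !rmorph_nat.
have red (h : K) : h ^+ p = - h -> 2%:R * h ^+ 2 = - 5%:R + f s ->
    ((- 5%:R + f s) / 2%:R) ^+ ((p - 1) %/ 2) = -1.
  move=> hh h2; rewrite -h2 mulrC mulKf //; apply: half_power_of_frobN => //.
  by apply: contraNneq a0 => h0; rewrite -h2 h0 expr0n mulr0.
(* The given root is the Gauss sum up to sign: the plus sign is handled by z^2 - z^3, the minus sign
   by z - z^4. *)
have : f s ^+ 2 == gauss5 K z ^+ 2 by rewrite gauss5_sqr // -rmorphXn hs rmorph_nat.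
rewrite eqf_sqr => /orP[] /eqP fs.
- by apply: (red _ (z23_frob _ _ _ charK hz hp)); rewrite two_sqr_z23 // fs.
- by apply: (red _ (z14_frob _ _ _ charK hz hp)); rewrite two_sqr_z14 // fs.
Qed.

(** The type ['Z_(pdiv p)] is the carrier of ['F_p], so the field results apply as they stand;
    [pdiv_id] later turns it into ['Z_p]. *)
Lemma proth_base_Fp_exists : (p %% 5 != 1)%N ->
  exists a : 'Z_(pdiv p), proth_base (pdiv p) a.
Proof.
move=> h1; case: (eqVneq (p %% 5)%N 4) => [h4|h4].
  have [s hs] := exists_sqrt5 h4.
  exists ((- 5%:R + s) / 2%:R); right; split; first by rewrite pdiv_id.
  by exists s; split => //; left.
exists 5%:R; left; split=> //.
rewrite (pdiv_id p_pr) !inE.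
by have := ltn_pmod p (isT : 0 < 5)%N; lia.
Qed.

Lemma proth_base_Fp_half_power (a : 'Z_(pdiv p)) : proth_base (pdiv p) a ->
  a ^+ ((p - 1) %/ 2) = -1.
Proof.
case=> [[h ->]|[h [s [hs ha]]]].
  apply: five_half_power; move: h; rewrite pdiv_id // !inE.
  case/or3P=> /eqP h; [|by left|by right].
  (* Residue 0 would make 5 divide the prime p > 5. *)
  by move: (dvdn_prime2 (isT : prime 5) p_pr); rewrite /dvdn h eqxx ltn_eqF.
rewrite pdiv_id // in h.
case: ha => ->; first exact: base4_half_power.
(* The other sign is the same statement for the root -s. *)
by apply: base4_half_power; rewrite // sqrrN.
Qed.

End PrimeField.

Theorem theorem1p4 (e t N : nat)
    (hN : N = (2 ^ e * t + 1)%N)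
    (hN5 : (5 < N)%N)
    (ht_odd : odd t)
    (ht : (0 < t < 2 ^ e)%N)
    (ht5 : ~~ (5 %| t)%N) :
  (prime N -> exists a : 'Z_N, proth_base N a) /\
  (forall a : 'Z_N, proth_base N a ->
     (prime N <-> a ^+ ((N - 1) %/ 2) = - 1)).
Proof.
have h1 : (N %% 5 != 1)%N.
  rewrite -[1%N]/(1 %% 5)%N eqn_mod_dvd ?hN ?addn1 // subn1 /=.
  by rewrite Euclid_dvdM // Euclid_dvdX.
split=> [N_pr|a ha].
  by have := proth_base_Fp_exists _ N_pr hN5 h1; rewrite pdiv_id.
split=> [N_pr|].
  by have := proth_base_Fp_half_power _ N_pr hN5; rewrite pdiv_id //; apply.
(* e = 0 leaves no [t], and e = 1 forces t = 1 and N = 3. *)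
have e1 : (1 < e)%N by case: e hN ht => [|[|]] //; lia.
by subst N; apply: proth_sufficient.
Qed.
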